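(* Let $X$ be a proper, geodesically complete $\mathrm{CAT}(-\kappa)$ space with height function $h_X$ based at $\infty_X\in\partial X$, let $N$ be an admissible monotone norm, and let $X'=(X,d'_X)$. If $f$ is an isometry of $X'$ whose boundary extension fixes $\infty_X$, then $h_X(f(x))-h_X(x)$ does not depend on $x\in X$.
   Context: $d'_X$ is the length metric on $X$ in which a path $\gamma$ has length $\sup_{0=t_0<\dots<t_n=1}\sum_iN(d_X(\gamma(t_i),\gamma(t_{i+1})),|h_X(\gamma(t_i))-h_X(\gamma(t_{i+1}))|)$, where $N$ is a norm on $\mathbb{R}^2$ with $N(1,1)=1$, $N(a,b)\ge(|a|+|b|)/2$, non-decreasing in each coordinate on $[0,\infty)^2$. $d'_X$ differs from $d_X$ by a bounded amount, so $X'$ is Gromov-hyperbolic with the same boundary as $X$, and isometries of $X'$ extend to the boundary. Height function: $h_X(x)=-\lim_{t\to\infty}[d_X(\gamma(t),x)-d_X(\gamma(t),x_0)]$ for a ray $\gamma$ representing $\infty_X$. *)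

(* Defs.v *)
From Stdlib Require Import Reals.
From Coquelicot Require Import Coquelicot.
Open Scope R_scope.

Section Defs.
Context {X : Type}.

Definition is_metric (d : X -> X -> R) : Prop :=
  (forall x y, 0 <= d x y) /\
  (forall x y, d x y = 0 <-> x = y) /\
  (forall x y, d x y = d y x) /\
  (forall x y z, d x z <= d x y + d y z).

Definition proper_space (d : X -> X -> R) : Prop :=
  forall (x : X) (r : R) (u : nat -> X),
    (forall n, d x (u n) <= r) ->
    exists (phi : nat -> nat) (y : X),
      (forall n, (phi n < phi (S n))%nat) /\ d x y <= r /\
      is_lim_seq (fun n => d (u (phi n)) y) 0.

Definition geod_seg (d : X -> X -> R) (c : R -> X) (x y : X) : Prop :=
  c 0 = x /\ c (d x y) = y /\
  forall s t, 0 <= s <= d x y -> 0 <= t <= d x y -> d (c s) (c t) = Rabs (s - t).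

Definition geodesic_space (d : X -> X -> R) : Prop :=
  forall x y, exists c, geod_seg d c x y.

Definition geod_line (d : X -> X -> R) (g : R -> X) : Prop :=
  forall s t, d (g s) (g t) = Rabs (s - t).

Definition geod_ray (d : X -> X -> R) (g : R -> X) : Prop :=
  forall s t, 0 <= s -> 0 <= t -> d (g s) (g t) = Rabs (s - t).

Definition geodesically_complete (d : X -> X -> R) : Prop :=
  forall (c : R -> X) (a b : R), a < b ->
    (forall s t, a <= s <= b -> a <= t <= b -> d (c s) (c t) = Rabs (s - t)) ->
    exists g, geod_line d g /\ forall t, a <= t <= b -> g t = c t.

End Defs.

(** Model space M^2_{-kappa}: hyperboloid model in R^3. *)
Definition hpt : Type := (R * R * R)%type.
Definition in_hyp (kappa : R) (u : hpt) : Prop :=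
  let '(u0, u1, u2) := u in - u0 ^ 2 + u1 ^ 2 + u2 ^ 2 = - / kappa /\ 0 < u0.
Definition arcosh (y : R) : R := ln (y + sqrt (y ^ 2 - 1)).
Definition hdist (kappa : R) (u v : hpt) : R :=
  let '(u0, u1, u2) := u in let '(v0, v1, v2) := v in
  arcosh (kappa * (u0 * v0 - u1 * v1 - u2 * v2)) / sqrt kappa.

Section CAT.
Context {X : Type}.

(** [p] lies on the side [c] (a geodesic segment from [a] to [b]) and [pb]
    is its comparison point on the model segment from [ab] to [bb]. *)
Definition on_side (kappa : R) (d : X -> X -> R) (c : R -> X) (a b : X)
  (ab bb : hpt) (p : X) (pb : hpt) : Prop :=
  in_hyp kappa pb /\
  exists s, 0 <= s <= d a b /\ p = c s /\
    hdist kappa ab pb = s /\ hdist kappa pb bb = d a b - s.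

Definition CAT_neg (kappa : R) (d : X -> X -> R) : Prop :=
  geodesic_space d /\
  forall (x y z : X) (c1 c2 c3 : R -> X) (xb yb zb : hpt),
    geod_seg d c1 x y -> geod_seg d c2 y z -> geod_seg d c3 z x ->
    in_hyp kappa xb -> in_hyp kappa yb -> in_hyp kappa zb ->
    hdist kappa xb yb = d x y -> hdist kappa yb zb = d y z ->
    hdist kappa zb xb = d z x ->
    forall (p q : X) (pb qb : hpt),
      (on_side kappa d c1 x y xb yb p pb \/ on_side kappa d c2 y z yb zb p pb
       \/ on_side kappa d c3 z x zb xb p pb) ->
      (on_side kappa d c1 x y xb yb q qb \/ on_side kappa d c2 y z yb zb q qb
       \/ on_side kappa d c3 z x zb xb q qb) ->
      d p q <= hdist kappa pb qb.

(** height function based at the boundary point represented by the ray [g],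
    normalised at the base point [x0]:
    h(x) = - lim_{t -> oo} [ d(g t, x) - d(g t, x0) ] *)
Definition height (d : X -> X -> R) (g : R -> X) (x0 : X) (x : X) : R :=
  - real (Lim (fun t => d (g t) x - d (g t) x0) p_infty).

End CAT.

Definition admissible_monotone_norm (N : R -> R -> R) : Prop :=
  (forall a b, N a b = 0 -> a = 0 /\ b = 0) /\
  (forall l a b, N (l * a) (l * b) = Rabs l * N a b) /\
  (forall a b a' b', N (a + a') (b + b') <= N a b + N a' b') /\
  N 1 1 = 1 /\
  (forall a b, (Rabs a + Rabs b) / 2 <= N a b) /\
  (forall a a' b, 0 <= a -> a <= a' -> 0 <= b -> N a b <= N a' b) /\
  (forall a b b', 0 <= a -> 0 <= b -> b <= b' -> N a b <= N a b').

Fixpoint psum (g : nat -> R) (n : nat) : R :=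
  match n with O => 0 | S k => psum g k + g k end.

Section Primed.
Context {X : Type}.

Definition cpath (d : X -> X -> R) (p : R -> X) (x y : X) : Prop :=
  p 0 = x /\ p 1 = y /\
  forall t, 0 <= t <= 1 -> forall eps, 0 < eps -> exists delta, 0 < delta /\
    forall s, 0 <= s <= 1 -> Rabs (s - t) < delta -> d (p s) (p t) < eps.

Definition partition (n : nat) (t : nat -> R) : Prop :=
  t O = 0 /\ t n = 1 /\ forall i, (i < n)%nat -> t i <= t (S i).

Definition Nlength (N : R -> R -> R) (d : X -> X -> R) (h : X -> R)
  (p : R -> X) : Rbar :=
  Lub_Rbar (fun l => exists n t, partition n t /\
    l = psum (fun i => N (d (p (t i)) (p (t (S i))))
                         (Rabs (h (p (t i)) - h (p (t (S i)))))) n).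

Definition dprime (N : R -> R -> R) (d : X -> X -> R) (h : X -> R)
  (x y : X) : R :=
  real (Glb_Rbar (fun l => exists p, cpath d p x y /\ Nlength N d h p = Finite l)).

Definition isometry (dist : X -> X -> R) (f : X -> X) : Prop :=
  (forall y, exists x, f x = y) /\ forall x y, dist (f x) (f y) = dist x y.

Definition gromov (dist : X -> X -> R) (w a b : X) : R :=
  (dist a w + dist b w - dist a b) / 2.

(** the boundary extension of [f] fixes the boundary point represented by the
    ray [g]: f(g(s)) converges to [g(+oo)] in the Gromov compactification of
    (X, dist), i.e. (f(g s) | g t)_w -> +oo as s, t -> +oo. *)
Definition fixes_boundary_point (dist : X -> X -> R) (w : X) (f : X -> X)
  (g : R -> X) : Prop :=
  forall M, exists K, forall s t, K <= s -> K <= t ->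
    M <= gromov dist w (f (g s)) (g t).

End Primed.

(* Main.v *)
Require Import Defs.
From Stdlib Require Import Reals ZArith Lra Lia.
From Coquelicot Require Import Coquelicot.
Open Scope R_scope.

(** Put k = sqrt kappa. Comparing one vertex of a triangle with the points of the opposite side
    gives a Stewart inequality; letting the vertex go to infinity along g gives its analogue for
    exp (- k h). Together they yield Ptolemy's inequality for three points and infinity:
    theta(p, q) = sinh (k d(p,q) / 2) exp (k (h p + h q) / 2) satisfies the triangle inequality.

    From (d + |dh|) / 2 <= d' <= d one sees that g is a d'-geodesic ray whose d'-Busemann function
    is - h up to a constant, so f o g is a d'-geodesic ray, and h o f - h is constant once the
    d'-Busemann function of f o g is also - h up to a constant. The defect t - h(f(g t)) is
    nondecreasing. It is bounded: theta(f(g i), f(g j)) is at most a sum of terms of order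
    exp (k h), and this exponential decay below the maximal height forces the ray to rise at unit
    speed up to a bounded error and then to fall at unit speed; as t + h(f(g t)) tends to infinity,
    it never falls. Hence the defect converges, and the triangle inequality for theta shows
    that d(f(g t), y) - (h(f(g t)) - h y) tends to 0 for every y. *)


(** * Hyperbolic functions *)

Lemma exp_le (a b : R) : a <= b -> exp a <= exp b.
Proof. intros [H | ->]; [left; now apply exp_increasing | right; reflexivity]. Qed.

Lemma cosh_minus (a b : R) : cosh (a - b) = cosh a * cosh b - sinh a * sinh b.
Proof.
unfold cosh, sinh; replace (- (a - b)) with (- a + b) by ring.
unfold Rminus; rewrite !exp_plus; field.
Qed.

Lemma sinh_minus (a b : R) : sinh (a - b) = sinh a * cosh b - cosh a * sinh b.
Proof.
unfold cosh, sinh; replace (- (a - b)) with (- a + b) by ring.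
unfold Rminus; rewrite !exp_plus; field.
Qed.

Lemma cosh_opp (a : R) : cosh (- a) = cosh a.
Proof. unfold cosh; rewrite Ropp_involutive; field. Qed.

Lemma sinh_opp (a : R) : sinh (- a) = - sinh a.
Proof. unfold sinh; rewrite Ropp_involutive; field. Qed.

Lemma cosh_plus (a b : R) : cosh (a + b) = cosh a * cosh b + sinh a * sinh b.
Proof.
replace (a + b) with (a - - b) by ring.
rewrite cosh_minus, cosh_opp, sinh_opp; ring.
Qed.

Lemma cosh2_sinh2 (a : R) : cosh a * cosh a - sinh a * sinh a = 1.
Proof. rewrite <- cosh_minus, Rminus_diag; apply cosh_0. Qed.

Lemma cosh_double (a : R) : cosh a = 1 + 2 * sinh (a / 2) ^ 2.
Proof.
pose proof (cosh2_sinh2 (a / 2)) as H.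
replace a with (a / 2 + a / 2) at 1 by field.
rewrite cosh_plus; nra.
Qed.

Lemma cosh_ge_1 (a : R) : 1 <= cosh a.
Proof. rewrite cosh_double; pose proof (pow2_ge_0 (sinh (a / 2))); lra. Qed.

Lemma sinh_le (a b : R) : a <= b -> sinh a <= sinh b.
Proof. intros [H | ->]; [left; now apply sinh_lt | right; reflexivity]. Qed.

Lemma sinh_ge_0 (a : R) : 0 <= a -> 0 <= sinh a.
Proof. intros H; rewrite <- sinh_0; now apply sinh_le. Qed.

Lemma sinh_gt_0 (a : R) : 0 < a -> 0 < sinh a.
Proof. intros H; rewrite <- sinh_0; now apply sinh_lt. Qed.

Lemma cosh_le (a b : R) : Rabs a <= b -> cosh a <= cosh b.
Proof.
intros H; rewrite (cosh_double a), (cosh_double b).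
enough (sinh (a / 2) ^ 2 <= sinh (b / 2) ^ 2) by lra.
apply pow_maj_Rabs.
apply Rabs_le_between in H.
apply Rabs_le; rewrite <- sinh_opp; split; apply sinh_le; lra.
Qed.

Lemma arcosh_cosh (a : R) : 0 <= a -> arcosh (cosh a) = a.
Proof.
intros H; unfold arcosh.
replace (cosh a ^ 2 - 1) with (sinh a ^ 2) by (pose proof (cosh2_sinh2 a); nra).
rewrite sqrt_pow2 by now apply sinh_ge_0.
replace (cosh a + sinh a) with (exp a) by (unfold cosh, sinh; field).
apply ln_exp.
Qed.

Lemma cosh_arcosh (y : R) : 1 <= y -> cosh (arcosh y) = y.
Proof.
intros H; unfold cosh, arcosh.
assert (Hs := sqrt_sqrt (y ^ 2 - 1) ltac:(nra)).
assert (Hp := sqrt_pos (y ^ 2 - 1)).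
rewrite exp_Ropp, exp_ln by lra.
apply Rmult_eq_reg_r with (2 * (y + sqrt (y ^ 2 - 1))); [| lra].
field_simplify; [nra | lra].
Qed.

(** * Stewart's inequality in CAT(-kappa) spaces *)

(** The hyperbolic form of Stewart's theorem: equality holds in the plane of curvature [- k ^ 2]. *)
Definition stewart {X : Type} (k : R) (d : X -> X -> R) : Prop :=
  forall (x y z : X) (c : R -> X) (s : R), geod_seg d c x y -> 0 <= s <= d x y ->
  cosh (k * d z (c s)) * sinh (k * d x y) <=
  cosh (k * d z x) * sinh (k * (d x y - s)) + cosh (k * d z y) * sinh (k * s).

(** Model points are written as vectors of the unit hyperboloid divided by [sqrt kappa], so the
    factor [kappa] in [hdist] cancels. *)
Lemma hdist_polar (kappa a b r u v : R) : 0 < kappa ->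
  kappa * (a / sqrt kappa * (r / sqrt kappa) - b / sqrt kappa * (u / sqrt kappa)
           - 0 * (v / sqrt kappa)) = a * r - b * u.
Proof.
intros Hk; assert (Hs := sqrt_lt_R0 _ Hk); assert (E := sqrt_sqrt kappa ltac:(lra)).
rewrite <- E at 1; field; lra.
Qed.

(** The comparison triangle is written down explicitly, with the side from [x] to [y] on the line
    [(cosh (k * t) / k, sinh (k * t) / k, 0)]; in the model Stewart's formula is then an
    identity. *)
Lemma CAT_neg_stewart {X : Type} (kappa : R) (d : X -> X -> R) :
  0 < kappa -> is_metric d -> CAT_neg kappa d -> stewart (sqrt kappa) d.
Proof.
intros Hkappa Hd [Hgeo Hcat] x y z c1 s Hc1 Hs.
pose proof Hd as (Hpos & Hzero & Hsym & Htri).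
assert (Hk := sqrt_lt_R0 _ Hkappa).
assert (Ek := sqrt_sqrt kappa ltac:(lra)).
set (k := sqrt kappa) in *.
set (L := d x y) in *.
destruct (Req_dec L 0) as [HL0 | HL0].
{ rewrite HL0 in Hs; replace s with 0 by lra; rewrite HL0.
  rewrite !Rminus_0_r, !Rmult_0_r, sinh_0; lra. }
assert (HL : 0 < L) by (pose proof (Hpos x y); unfold L in *; lra).
destruct (Hgeo y z) as [c2 Hc2]; destruct (Hgeo z x) as [c3 Hc3].
set (a := d z x); set (b := d y z).
assert (Ha : 0 <= a) by apply Hpos.
assert (Hb : 0 <= b) by apply Hpos.
assert (T1 : L <= a + b)
  by (unfold L, a, b; rewrite (Hsym z x), (Hsym y z); apply Htri).
assert (T2 : a <= L + b)
  by (unfold L, a, b; rewrite (Hsym z x); apply Htri).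
assert (T3 : b <= L + a)
  by (unfold L, a, b; rewrite (Hsym z x), (Hsym x y); apply Htri).
assert (HsL : 0 < sinh (k * L)) by (apply sinh_gt_0; nra).
assert (Hsa : 0 <= sinh (k * a)) by (apply sinh_ge_0; nra).
assert (Hss : 0 <= sinh (k * s)) by (apply sinh_ge_0; nra).
(* The law of cosines dictates this coordinate: it puts the third vertex at model distance [b] from
   the vertex for [y]. *)
set (u := (cosh (k * L) * cosh (k * a) - cosh (k * b)) / sinh (k * L)).
assert (Eu : cosh (k * L) * cosh (k * a) - sinh (k * L) * u = cosh (k * b))
  by (unfold u; field; lra).
(* The triangle inequalities give [u ^ 2 <= sinh (k * a) ^ 2], so the last coordinate [v] is a
   genuine square root. *)
assert (Hu : - sinh (k * a) <= u <= sinh (k * a)).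
{ assert (C1 : cosh (k * L - k * a) <= cosh (k * b)).
  { apply cosh_le, Rabs_le; split; nra. }
  assert (C2 : cosh (k * b) <= cosh (k * L + k * a)).
  { apply cosh_le; rewrite Rabs_pos_eq; nra. }
  rewrite cosh_minus in C1; rewrite cosh_plus in C2; split; nra. }
assert (Hv := sqrt_sqrt (sinh (k * a) ^ 2 - u ^ 2) ltac:(nra)).
set (v := sqrt (sinh (k * a) ^ 2 - u ^ 2)) in *.
assert (Hza := cosh2_sinh2 (k * a)).
assert (HQ : 1 <= cosh (k * s) * cosh (k * a) - sinh (k * s) * u).
{ pose proof (cosh_ge_1 (k * s - k * a)) as C; rewrite cosh_minus in C; nra. }
assert (Hon : forall t, in_hyp kappa (cosh t / k, sinh t / k, 0)).
{ intros t; simpl; pose proof (cosh2_sinh2 t); pose proof (cosh_ge_1 t).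
  split; [rewrite <- Ek; field_simplify; [| lra | lra] | apply Rdiv_lt_0_compat; lra].
  replace (- cosh t ^ 2 + sinh t ^ 2) with (-1) by nra; field; lra. }
assert (Hzb : in_hyp kappa (cosh (k * a) / k, u / k, v / k)).
{ simpl; pose proof (cosh_ge_1 (k * a)).
  split; [rewrite <- Ek; field_simplify; [| lra | lra] | apply Rdiv_lt_0_compat; lra].
  replace (- cosh (k * a) ^ 2 + u ^ 2 + v ^ 2) with (-1) by nra; field; lra. }
assert (Hpp : forall t t', t <= t' ->
  hdist kappa (cosh (k * t) / k, sinh (k * t) / k, 0)
              (cosh (k * t') / k, sinh (k * t') / k, 0) = t' - t).
{ intros t t' Ht; unfold hdist; fold k.
  replace 0 with (0 / k) at 2 by (field; lra).
  unfold k at 1 2 3 4 5 6; rewrite hdist_polar by assumption; fold k.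
  replace (cosh (k * t) * cosh (k * t') - sinh (k * t) * sinh (k * t'))
    with (cosh (k * (t' - t)))
    by (rewrite Rmult_minus_distr_l, cosh_minus; ring).
  rewrite arcosh_cosh by nra; field; lra. }
assert (Hpz : forall t,
  hdist kappa (cosh (k * t) / k, sinh (k * t) / k, 0)
              (cosh (k * a) / k, u / k, v / k)
  = arcosh (cosh (k * t) * cosh (k * a) - sinh (k * t) * u) / k).
{ intros t; unfold hdist; fold k.
  unfold k at 1 2 3 4 5 6; rewrite hdist_polar by assumption; reflexivity. }
assert (Hd_pz : d (c1 s) z <=
  arcosh (cosh (k * s) * cosh (k * a) - sinh (k * s) * u) / k).
{ rewrite <- Hpz.
  assert (Hyz : hdist kappa (cosh (k * L) / k, sinh (k * L) / k, 0)
              (cosh (k * a) / k, u / k, v / k) = b).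
  { rewrite Hpz, Eu, arcosh_cosh by nra; field; lra. }
  eapply (Hcat x y z c1 c2 c3 (cosh (k * 0) / k, sinh (k * 0) / k, 0)
    (cosh (k * L) / k, sinh (k * L) / k, 0) (cosh (k * a) / k, u / k, v / k));
    try assumption; try apply Hon.
  - rewrite Hpp; fold L; lra.
  - transitivity (hdist kappa (cosh (k * 0) / k, sinh (k * 0) / k, 0)
       (cosh (k * a) / k, u / k, v / k)).
    + unfold hdist; do 2 f_equal; ring.
    + rewrite Hpz, Rmult_0_r, cosh_0, sinh_0.
      replace (1 * cosh (k * a) - 0 * u) with (cosh (k * a)) by ring.
      rewrite arcosh_cosh by nra; unfold a; field; lra.
  - left; split; [apply Hon |].
    exists s; fold L; repeat split; try lra; rewrite Hpp; lra.
  (* [z] is taken as the far end of the second side; what remains is that a model point has distance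
     0 to itself. *)
  - right; left; split; [assumption |].
    exists b; fold b; destruct Hc2 as (_ & Hc2 & _); repeat split;
      [lra | lra | now symmetry | assumption |].
    unfold hdist; fold k.
    replace (kappa * _) with (cosh 0).
    { rewrite arcosh_cosh by lra; field; lra. }
    rewrite cosh_0, <- Ek.
    field_simplify; [| lra]; nra. }
assert (HC : cosh (k * d z (c1 s)) <= cosh (k * s) * cosh (k * a) - sinh (k * s) * u).
{ rewrite <- (cosh_arcosh (cosh (k * s) * cosh (k * a) - sinh (k * s) * u)) by exact HQ.
  apply cosh_le; rewrite Hsym, Rabs_pos_eq by (pose proof (Hpos (c1 s) z); nra).
  apply (Rmult_le_compat_l k) in Hd_pz; [| lra].
  eapply Rle_trans; [exact Hd_pz |]; right; field; lra. }
rewrite (Hsym z y); fold a b.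
rewrite Rmult_minus_distr_l, sinh_minus, <- Eu.
nra.
Qed.

(** * Busemann functions *)

Definition horo_stewart {X : Type} (k : R) (d : X -> X -> R) (h : X -> R) : Prop :=
  forall (x y : X) (c : R -> X) (s : R), geod_seg d c x y -> 0 <= s <= d x y ->
  exp (- (k * h (c s))) * sinh (k * d x y) <=
  exp (- (k * h x)) * sinh (k * (d x y - s)) + exp (- (k * h y)) * sinh (k * s).

(** By the triangle inequality [t - d (g t) x] is nondecreasing for [t >= 0] and at most
    [d (g 0) x], so it converges to its supremum. *)
Lemma ex_busemann {X : Type} (d : X -> X -> R) (g : R -> X) (x : X) :
  is_metric d -> geod_ray d g ->
  exists b : R, is_lim (fun t => d (g t) x - t) p_infty b.
Proof.
intros Hd Hg; pose proof Hd as (Hpos & _ & Hsym & Htri).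
destruct (completeness (fun r => exists t, 0 <= t /\ r = - (d (g t) x - t)))
  as [m [Hub Hlub]].
- exists (d (g 0) x); intros r (t & Ht & ->).
  pose proof (Htri (g 0) x (g t)); rewrite (Hsym x) in H.
  rewrite (Hg 0 t), Rabs_left1 in H by lra; lra.
- exists (- (d (g 0) x - 0)), 0; split; [lra | reflexivity].
- exists (- m).
  apply is_lim_spec; intros eps; simpl.
  destruct (Classical_Prop.classic
    (exists t, 0 <= t /\ m - eps < - (d (g t) x - t))) as [(T & HT & HT') | Hno].
  + exists T; intros t Ht.
    assert (- (d (g t) x - t) <= m) by (apply Hub; exists t; split; [lra | reflexivity]).
    pose proof (Htri (g t) (g T) x).
    rewrite (Hg t T), Rabs_pos_eq in H0 by lra.
    apply Rabs_lt_between; lra.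
  + exfalso; enough (m <= m - eps) by (pose proof (cond_pos eps); lra).
    apply Hlub; intros r (t & Ht & ->).
    apply Rnot_lt_le; intros C; apply Hno; exists t; now split.
Qed.

(** [Lim] is total, so [height] has its intended value only once the limits are known to be
    finite. *)
Lemma height_busemann {X : Type} (d : X -> X -> R) (g : R -> X) (x0 x : X) (b0 b : R) :
  is_lim (fun t => d (g t) x0 - t) p_infty b0 ->
  is_lim (fun t => d (g t) x - t) p_infty b ->
  height d g x0 x = b0 - b.
Proof.
intros H0 H; unfold height.
rewrite (is_lim_unique _ _ (Finite (b - b0))); [simpl; ring |].
apply is_lim_ext with (fun t => (d (g t) x - t) - (d (g t) x0 - t)); [intros; ring |].
now apply (is_lim_minus' _ _ p_infty b b0).
Qed.

Lemma is_lim_height {X : Type} (d : X -> X -> R) (g : R -> X) (x0 x : X) (b0 : R) :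
  is_metric d -> geod_ray d g ->
  is_lim (fun t => d (g t) x0 - t) p_infty b0 ->
  is_lim (fun t => d (g t) x - t) p_infty (b0 - height d g x0 x).
Proof.
intros Hd Hg H0; destruct (ex_busemann d g x Hd Hg) as [b Hb].
rewrite (height_busemann d g x0 x b0 b H0 Hb).
now replace (b0 - (b0 - b)) with b by ring.
Qed.

Lemma height_Lipschitz {X : Type} (d : X -> X -> R) (g : R -> X) (x0 x y : X) :
  is_metric d -> geod_ray d g ->
  Rabs (height d g x0 x - height d g x0 y) <= d x y.
Proof.
intros Hd Hg; destruct (ex_busemann d g x0 Hd Hg) as [b0 H0].
pose proof (is_lim_height d g x0 x b0 Hd Hg H0) as Hx.
pose proof (is_lim_height d g x0 y b0 Hd Hg H0) as Hy.
assert (L : forall u v, Rbar_le (b0 - height d g x0 u) (b0 - height d g x0 v + d u v)).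
{ intros u v.
  pose proof (is_lim_height d g x0 u b0 Hd Hg H0) as Hu.
  pose proof (is_lim_height d g x0 v b0 Hd Hg H0) as Hv.
  apply (is_lim_le_loc (fun t => d (g t) u - t) (fun t => d (g t) v - t + d u v) p_infty).
  - exists 0; intros t _; destruct Hd as (_ & _ & Hsym & Htri).
    pose proof (Htri (g t) v u); rewrite (Hsym v u) in H; lra.
  - exact Hu.
  - apply (is_lim_plus' _ _ p_infty _ (d u v) Hv), is_lim_const. }
pose proof (L x y) as L1; pose proof (L y x) as L2; simpl in L1, L2.
destruct Hd as (_ & _ & Hsym & _); rewrite (Hsym y x) in L2.
apply Rabs_le; lra.
Qed.

Lemma height_ray {X : Type} (d : X -> X -> R) (g : R -> X) (x0 : X) (b0 t : R) :
  geod_ray d g -> is_lim (fun t => d (g t) x0 - t) p_infty b0 -> 0 <= t ->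
  height d g x0 (g t) = b0 + t.
Proof.
intros Hg H0 Ht.
rewrite (height_busemann d g x0 (g t) b0 (- t) H0); [ring |].
apply is_lim_ext_loc with (fun _ => - t); [| apply is_lim_const].
exists t; intros u Hu; rewrite (Hg u t), Rabs_pos_eq by lra; ring.
Qed.

(** Stewart's inequality at the vertex [g t] is multiplied by [2 * exp (- (k * t))]; each [cosh]
    term then converges, and the common factor [exp (k * b0)] cancels. *)
Lemma stewart_horo {X : Type} (k : R) (d : X -> X -> R) (g : R -> X) (x0 : X) :
  0 < k -> is_metric d -> geod_ray d g -> stewart k d ->
  horo_stewart k d (height d g x0).
Proof.
intros Hk Hd Hg HS x y c s Hc Hs.
destruct (ex_busemann d g x0 Hd Hg) as [b0 H0].
assert (Lc : forall u, is_lim (fun t => 2 * exp (- (k * t)) * cosh (k * d (g t) u)) p_infty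
                        (exp (k * b0) * exp (- (k * height d g x0 u)))).
{ intros u; pose proof (is_lim_height d g x0 u b0 Hd Hg H0) as Hu.
  (* The second summand is [exp (- k * (d (g t) u + t))], which tends to 0: only the growing half of
     [cosh] survives. *)
  apply is_lim_ext with (fun t => exp (k * (d (g t) u - t))
    + exp (- (k * (d (g t) u - t + 2 * t)))).
  { intros t; unfold cosh; field_simplify.
    rewrite <- !exp_plus; f_equal; f_equal; ring. }
  rewrite <- exp_plus.
  replace (exp (k * b0 + - (k * height d g x0 u)))
    with (exp (k * (b0 - height d g x0 u)) + 0) by (rewrite Rplus_0_r; f_equal; ring).
  apply is_lim_plus'.
  - apply (is_lim_comp_continuous (fun t => k * (d (g t) u - t)) exp p_infty
      (k * (b0 - height d g x0 u))).
    + apply (is_lim_scal_l _ k p_infty (Finite (b0 - height d g x0 u)) Hu).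
    + apply continuous_exp.
  - apply is_lim_le_le_loc with (fun _ => 0) (fun t => exp (- (k * t))).
    + exists (d (g 0) u); intros t Ht; split; [left; apply exp_pos |].
      apply exp_le; apply Ropp_le_contravar, Rmult_le_compat_l; [lra |].
      pose proof Hd as (Hpos & _ & Hsym & Htri).
      pose proof (Hpos (g t) u); lra.
    + apply is_lim_const.
    + apply (is_lim_comp exp _ p_infty 0 m_infty); [apply is_lim_exp_m | | ].
      * apply is_lim_ext with (fun t => (- k) * t); [intros; ring |].
        replace m_infty with (Rbar_mult (- k) p_infty).
        { apply is_lim_scal_l, is_lim_id. }
        simpl; destruct (Rle_dec 0 (- k)); [exfalso; lra | reflexivity].
      * exists 0; intros; discriminate. }
set (S1 := sinh (k * d x y)); set (S2 := sinh (k * (d x y - s))); set (S3 := sinh (k * s)).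
assert (E : Rbar_le (exp (k * b0) * exp (- (k * height d g x0 (c s))) * S1)
  (exp (k * b0) * exp (- (k * height d g x0 x)) * S2
   + exp (k * b0) * exp (- (k * height d g x0 y)) * S3)).
{ apply (is_lim_le_loc
    (fun t => 2 * exp (- (k * t)) * cosh (k * d (g t) (c s)) * S1)
    (fun t => 2 * exp (- (k * t)) * cosh (k * d (g t) x) * S2
       + 2 * exp (- (k * t)) * cosh (k * d (g t) y) * S3) p_infty).
  - exists 0; intros t _.
    pose proof (HS x y (g t) c s Hc Hs) as H; fold S1 S2 S3 in H.
    pose proof (exp_pos (- (k * t))); nra.
  - apply (is_lim_scal_r _ S1 p_infty (Finite _) (Lc (c s))).
  - apply is_lim_plus'.
    + apply (is_lim_scal_r _ S2 p_infty (Finite _) (Lc x)).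
    + apply (is_lim_scal_r _ S3 p_infty (Finite _) (Lc y)). }
simpl in E; pose proof (exp_pos (k * b0)).
apply Rmult_le_reg_l with (exp (k * b0)); [assumption | lra].
Qed.

(** * Ptolemy's inequality with a point at infinity *)

(* With k = 1, in the upper half-plane with h = ln y, this is half the Euclidean distance. *)
Definition theta {X : Type} (k : R) (d : X -> X -> R) (h : X -> R) (p q : X) : R :=
  sinh (k * d p q / 2) * exp (k * (h p + h q) / 2).

(** This locates the point of a side at which [theta_triangle] uses both Stewart inequalities;
    positivity of [al] and [be] keeps it off the endpoints. *)
Lemma sinh_ratio (L al be : R) : 0 < L -> 0 < al -> 0 < be ->
  exists s, 0 <= s <= L /\ 0 < sinh s /\ 0 < sinh (L - s) /\
    al * sinh (L - s) = be * sinh s.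
Proof.
intros HL Hal Hbe.
assert (HsL := sinh_gt_0 L HL).
destruct (IVT (fun s => be * sinh s - al * sinh (L - s)) 0 L) as (s & Hs & Es).
- intros s; reg.
- assumption.
- rewrite sinh_0, Rminus_0_r; nra.
- rewrite Rminus_diag, sinh_0; nra.
- exists s.
  assert (H1 := sinh_ge_0 s ltac:(lra)); assert (H2 := sinh_ge_0 (L - s) ltac:(lra)).
  assert (s <> 0) by (intros E; rewrite E, Rminus_0_r, sinh_0 in Es; nra).
  assert (s <> L) by (intros E; rewrite E, Rminus_diag, sinh_0 in Es; nra).
  repeat split; try lra; apply sinh_gt_0; lra.
Qed.

(** Both Stewart inequalities are applied at one point [m] of the side from [x] to [y]. The
    Lipschitz bound for [h] links them, and the unknown [d z m] is eliminated by completing a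
    square. *)
Lemma theta_triangle {X : Type} (k : R) (d : X -> X -> R) (h : X -> R) (x y z : X) :
  0 < k -> is_metric d -> geodesic_space d ->
  (forall u v, Rabs (h u - h v) <= d u v) -> stewart k d -> horo_stewart k d h ->
  theta k d h x y <= theta k d h x z + theta k d h z y.
Proof.
intros Hk (Hpos & Hzero & Hsym & Htri) Hgeo Hh HS HH.
assert (Hth : forall u v, 0 <= theta k d h u v).
{ intros u v; pose proof (Hpos u v); apply Rmult_le_pos;
    [apply sinh_ge_0; nra | left; apply exp_pos]. }
destruct (Req_dec (d x y) 0) as [E0 | N0].
{ pose proof (Hth x z); pose proof (Hth z y); unfold theta at 1; rewrite E0.
  rewrite Rmult_0_r, Rdiv_0_l, sinh_0; lra. }
destruct (Req_dec (d z x) 0) as [E1 | N1].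
{ apply Hzero in E1; subst x; pose proof (Hth z z); lra. }
destruct (Req_dec (d z y) 0) as [E2 | N2].
{ apply Hzero in E2; subst y; pose proof (Hth z z); lra. }
assert (HL : 0 < k * d x y) by (pose proof (Hpos x y); nra).
assert (Hz1 : 0 < k * d z x) by (pose proof (Hpos z x); nra).
assert (Hz2 : 0 < k * d z y) by (pose proof (Hpos z y); nra).
destruct (Hgeo x y) as [c Hc].
set (a := sinh (k * d z x / 2)); set (b := sinh (k * d z y / 2)).
set (S := sinh (k * d x y / 2)).
set (xi := exp (- (k * h x) / 2)); set (eta := exp (- (k * h y) / 2)).
set (ze := exp (- (k * h z) / 2)).
assert (Ha : 0 < a) by (apply sinh_gt_0; lra).
assert (Hb : 0 < b) by (apply sinh_gt_0; lra).
assert (HSp : 0 < S) by (apply sinh_gt_0; lra).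
assert (Hxi : 0 < xi) by apply exp_pos.
assert (Heta : 0 < eta) by apply exp_pos.
assert (Hze : 0 < ze) by apply exp_pos.
assert (Sq : forall t, exp (- (k * t)) = exp (- (k * t) / 2) ^ 2).
{ intros t; simpl; rewrite Rmult_1_r, <- exp_plus; f_equal; field. }
(* This is the claim divided by [exp (k * (h x + h y + h z) / 2)]. *)
assert (Main : S * ze <= a * eta + b * xi).
{ (* this ratio turns the product of the two Stewart bounds into a perfect square (K3) *)
  destruct (sinh_ratio (k * d x y) (a * xi) (b * eta)) as (s' & Hs' & P1 & P2 & Er);
    [lra | nra | nra |].
  set (s := s' / k).
  assert (Es : k * s = s') by (unfold s; field; lra).
  assert (Hs : 0 <= s <= d x y) by (split; apply Rmult_le_reg_l with k; lra).
  assert (Es2 : k * (d x y - s) = k * d x y - s') by (rewrite <- Es; ring).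
  pose proof (HS x y z c s Hc Hs) as I1; pose proof (HH x y c s Hc Hs) as I2.
  rewrite Es, Es2 in I1, I2.
  set (T := sinh (k * d x y)) in *.
  assert (HT : 0 < T) by (apply sinh_gt_0; lra).
  set (la := sinh (k * d x y - s')) in *; set (mu := sinh s') in *.
  assert (Elm : T ^ 2 - (la + mu) ^ 2 = 4 * la * mu * S ^ 2).
  { replace (4 * la * mu * S ^ 2) with (2 * la * mu * (cosh (k * d x y) - 1))
      by (rewrite (cosh_double (k * d x y)); fold S; ring).
    unfold la, T; rewrite sinh_minus; fold mu.
    pose proof (cosh2_sinh2 (k * d x y)); pose proof (cosh2_sinh2 s') as Q; fold mu in Q.
    set (C := cosh (k * d x y)) in *; set (U := sinh (k * d x y)) in *.
    replace (U ^ 2) with (U * U * (cosh s' * cosh s' - mu * mu)) by (rewrite Q; ring).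
    replace (2 * (U * cosh s' - C * mu) * mu * (C - 1)) with
      (2 * U * cosh s' * mu * C - 2 * U * cosh s' * mu - 2 * (C * C) * mu * mu
        + 2 * C * mu * mu) by ring.
    replace ((U * cosh s' - C * mu + mu) ^ 2) with
      (U * U * (cosh s' * cosh s') + C * C * mu * mu + mu * mu
       - 2 * U * cosh s' * C * mu + 2 * U * cosh s' * mu - 2 * C * mu * mu) by ring.
    replace (C * C) with (1 + U * U) by lra; ring. }
  set (m := c s) in *; set (r := k * d z m) in *.
  (* The bound [h m <= h z + d z m] trades the height of [m] for that of [z], at the cost of the
     factor [exp (- r)]. *)
  assert (Hq : ze ^ 2 * exp (- r) * T <= xi ^ 2 * la + eta ^ 2 * mu).
  { unfold ze, xi, eta; rewrite <- !Sq.
    eapply Rle_trans; [| exact I2].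
    apply Rmult_le_compat_r; [lra |].
    rewrite <- exp_plus; apply exp_le; unfold r.
    pose proof (Hh z m) as Hzm; apply Rabs_le_between in Hzm; nra. }
  rewrite (cosh_double (k * d z x)), (cosh_double (k * d z y)) in I1; fold a b in I1.
  set (q := exp (- r)) in *.
  assert (Hq0 : 0 < q) by apply exp_pos.
  assert (Eq : 2 * cosh r * q = 1 + q ^ 2).
  { unfold cosh; fold q; assert (exp r * q = 1)
      by (unfold q; rewrite <- exp_plus, Rplus_opp_r; apply exp_0); nra. }
  assert (HqT : 0 < q * T) by nra.
  (* Multiplying by [2 * (q * T)] turns [cosh r] into [1 + q ^ 2]. The square of [q * T - (la + mu)]
     then removes the terms without [a] and [b], up to the difference computed in [Elm]. *)
  assert (Key : la * mu * S ^ 2 <= q * T * (la * a ^ 2 + mu * b ^ 2)).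
  { pose proof (pow2_ge_0 (q * T - (la + mu))) as Hsq.
    apply (Rmult_le_compat_l (2 * (q * T))) in I1; [| lra].
    replace (2 * (q * T) * (cosh r * T)) with (2 * cosh r * q * T ^ 2) in I1 by ring.
    rewrite Eq in I1; lra. }
  assert (Key2 : la * mu * (S * ze) ^ 2 <= la * mu * (a * eta + b * xi) ^ 2).
  { assert (Hw : 0 <= la * a ^ 2 + mu * b ^ 2) by (pose proof (pow2_ge_0 a);
      pose proof (pow2_ge_0 b); nra).
    assert (K1 : la * mu * S ^ 2 * ze ^ 2 <= q * T * (la * a ^ 2 + mu * b ^ 2) * ze ^ 2)
      by (apply Rmult_le_compat_r; [apply pow2_ge_0 | exact Key]).
    assert (K2 : ze ^ 2 * q * T * (la * a ^ 2 + mu * b ^ 2) <=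
      (xi ^ 2 * la + eta ^ 2 * mu) * (la * a ^ 2 + mu * b ^ 2))
      by (apply Rmult_le_compat_r; assumption).
    assert (K3 : (a * xi * la) ^ 2 + (b * eta * mu) ^ 2 = 2 * (a * xi * la) * (b * eta * mu))
      by (rewrite Er; ring).
    lra. }
  assert (0 < la * mu) by nra.
  apply Rmult_le_reg_l in Key2; [| assumption].
  apply Rsqr_incr_0_var; [unfold Rsqr; lra | nra]. }
assert (W : forall t, exp (k * t / 2) * exp (- (k * t) / 2) = 1).
{ intros t; rewrite <- exp_plus; rewrite <- exp_0; f_equal; field. }
assert (F : forall u v, exp (k * (u + v) / 2) = exp (k * u / 2) * exp (k * v / 2)).
{ intros; rewrite <- exp_plus; f_equal; field. }
unfold theta; rewrite !F, (Hsym x z); fold a b S.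
pose proof (W (h x)) as Wx; pose proof (W (h y)) as Wy; pose proof (W (h z)) as Wz.
fold xi in Wx; fold eta in Wy; fold ze in Wz.
set (ex := exp (k * h x / 2)) in *; set (ey := exp (k * h y / 2)) in *;
set (ez := exp (k * h z / 2)) in *.
assert (0 < ex * ey * ez) by (repeat apply Rmult_lt_0_compat; apply exp_pos).
apply (Rmult_le_compat_l (ex * ey * ez)) in Main; [| lra].
replace (ex * ey * ez * (S * ze)) with (S * (ex * ey) * (ez * ze)) in Main by ring.
replace (ex * ey * ez * (a * eta + b * xi)) with
  (a * (ex * ez) * (ey * eta) + b * (ez * ey) * (ex * xi)) in Main by ring.
rewrite Wx, Wy, Wz in Main; lra.
Qed.


(** * Heights along quasi-geodesic sequences *)

Lemma psum_le (u v : nat -> R) (n : nat) :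
  (forall i, (i < n)%nat -> u i <= v i) -> psum u n <= psum v n.
Proof.
induction n as [| n IH]; simpl; intros H; [lra |].
apply Rplus_le_compat; [apply IH; intros; apply H; lia | apply H; lia].
Qed.

Lemma psum_const (a : R) (n : nat) : psum (fun _ => a) n = INR n * a.
Proof. induction n as [| n IH]; [simpl; ring | rewrite S_INR; simpl; rewrite IH; ring]. Qed.

Lemma psum_scal (a : R) (u : nat -> R) (n : nat) :
  psum (fun i => a * u i) n = a * psum u n.
Proof. induction n as [| n IH]; simpl; [ring | rewrite IH; ring]. Qed.

Lemma inv_sqr_telescope (r : R) : 1 <= r -> / r ^ 2 + 2 / (r + 1) <= 2 / r.
Proof.
intros H; apply Rminus_le_0.
replace (2 / r - (/ r ^ 2 + 2 / (r + 1))) with ((r - 1) / (r ^ 2 * (r + 1)))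
  by (field; lra).
apply Rdiv_le_0_compat; [lra | nra].
Qed.

(** Inverse squares have telescoping bounds, so each side of the peak contributes at most
    [2 * A * w m]. *)
Lemma psum_peak (w : nat -> R) (A : R) (m n : nat) :
  (m <= n)%nat -> 0 <= A -> 0 <= w m ->
  (forall l r, (1 <= r)%nat -> (l <= n)%nat -> (l + r = m)%nat \/ (l = m + r)%nat ->
     w l <= A * w m * / INR r ^ 2) ->
  psum w (S n) <= (1 + 4 * A) * w m.
Proof.
intros Hmn HA Hw Hl.
assert (HAw : 0 <= A * w m) by nra.
(* [r] is the gap between [j] and [m]: the terms before [j] lie at distance at least [r + 1] from
   [m]. *)
assert (Left : forall j r, (j + r = m)%nat -> psum w j <= A * w m * (2 / (INR r + 1))).
{ induction j as [| j IH]; intros r Hr; simpl.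
  - apply Rmult_le_pos; [lra |].
    pose proof (pos_INR r); apply Rdiv_le_0_compat; lra.
  - assert (H1 := IH (S r) ltac:(lia)).
    assert (H2 := Hl j (S r) ltac:(lia) ltac:(lia) ltac:(lia)).
    rewrite S_INR in H1, H2; pose proof (pos_INR r).
    assert (H3 := inv_sqr_telescope (INR r + 1) ltac:(lra)).
    apply (Rmult_le_compat_l (A * w m)) in H3; [| lra].
    rewrite Rmult_plus_distr_l in H3; lra. }
assert (Right : forall i, (m + i <= n)%nat ->
  psum w (S (m + i)) <= (1 + 2 * A) * w m + A * w m * (2 - 2 / (INR i + 1))).
{ induction i as [| i IH]; intros Hi.
  - rewrite Nat.add_0_r; simpl.
    assert (H1 := Left m 0%nat ltac:(lia)); simpl in H1; lra.
  - assert (H1 := IH ltac:(lia)).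
    assert (H2 := Hl (m + S i)%nat (S i) ltac:(lia) ltac:(lia) ltac:(lia)).
    change (psum w (S (m + S i))) with (psum w (m + S i) + w (m + S i)%nat).
    replace (psum w (m + S i)) with (psum w (S (m + i))) by (f_equal; lia).
    rewrite S_INR in H2 |- *; pose proof (pos_INR i).
    assert (H3 := inv_sqr_telescope (INR i + 1) ltac:(lra)).
    apply (Rmult_le_compat_l (A * w m)) in H3; [| lra].
    rewrite Rmult_plus_distr_l in H3; lra. }
assert (H1 := Right (n - m)%nat ltac:(lia)).
replace (m + (n - m))%nat with n in H1 by lia.
pose proof (pos_INR (n - m)).
assert (0 <= A * w m * (2 / (INR (n - m) + 1)))
  by (apply Rmult_le_pos; [lra | apply Rdiv_le_0_compat; lra]).
lra.
Qed.

Lemma argmax (H : nat -> R) (n : nat) :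
  exists m, (m <= n)%nat /\ forall l, (l <= n)%nat -> H l <= H m.
Proof.
induction n as [| n (m & Hm & Hmax)].
- exists 0%nat; split; [lia |]; intros l Hl; replace l with 0%nat by lia; lra.
- destruct (Rle_dec (H m) (H (S n))) as [Hle | Hnle].
  + exists (S n); split; [lia |]; intros l Hl.
    destruct (Nat.eq_dec l (S n)) as [-> | Hne]; [lra |].
    specialize (Hmax l ltac:(lia)); lra.
  + exists m; split; [lia |]; intros l Hl.
    destruct (Nat.eq_dec l (S n)) as [-> | Hne]; [lra |].
    apply Hmax; lia.
Qed.

(** This squares [exp (y / 2) >= 1 + y / 2]. Quadratic growth is enough to beat the linear growth of
    a sum of [r] bounded terms. *)
Lemma sinh_ge_sqr (y : R) : 0 <= y -> y ^ 2 / 8 <= sinh y.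
Proof.
intros Hy; unfold sinh.
assert (exp (- y) <= 1) by (rewrite <- exp_0; apply exp_le; lra).
assert (Hh := exp_ineq1_le (y / 2)).
replace (exp y) with (exp (y / 2) * exp (y / 2))
  by (rewrite <- exp_plus; f_equal; field).
nra.
Qed.

(* H is the height along a path whose steps have bounded length while d(i, i+r) >= r, and the
   hypothesis bounds theta(i, i+r) by the sum of the thetas of the steps. By the lower bound on
   sinh, exp (k H) decays at least like the inverse square of the distance to its maximum, so
   its sum is comparable to its largest term. *)
Lemma path_rises_then_falls (k c : R) (H : nat -> R) :
  0 < k -> 0 < c ->
  (forall i r, sinh (k * INR r / 2) * exp (k * (H i + H (i + r)%nat) / 2)
     <= c * psum (fun l => exp (k * H (i + l)%nat)) r) ->
  exists C, forall n, exists m, (m <= n)%nat /\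
    (forall l, (l <= n)%nat -> H l <= H m) /\ INR n + H n <= 2 * H m + C.
Proof.
intros Hk Hc Hyp.
(* [B] comes from [sinh (k * r / 2) >= k ^ 2 * r ^ 2 / 32], and [A] from squaring the decay
   estimate. The final [1] in [D] absorbs [exp (- (k * n / 2))]. *)
set (B := 32 * c / k ^ 2); set (A := B ^ 2).
set (D := 2 * c * (1 + 4 * A) + 1).
assert (HA : 0 <= A) by apply pow2_ge_0.
assert (HD : 0 < D) by (unfold D; nra).
exists (2 * ln D / k - H 0%nat); intros n.
destruct (argmax H n) as (m & Hmn & Hmax); exists m; do 2 (split; [assumption |]).
assert (Hw : forall l, (l <= n)%nat -> exp (k * H l) <= exp (k * H m)).
{ intros l Hl; apply exp_le, Rmult_le_compat_l; [lra | now apply Hmax]. }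
assert (Decay : forall i r, (1 <= r)%nat -> (i + r <= n)%nat ->
  exp (k * (H i + H (i + r)%nat) / 2) <= B * exp (k * H m) * / INR r).
{ intros i r Hr Hir.
  assert (HrR : 1 <= INR r) by (apply (le_INR 1), Hr).
  assert (Hs := sinh_ge_sqr (k * INR r / 2) ltac:(nra)).
  assert (Hsum : psum (fun l => exp (k * H (i + l)%nat)) r <= INR r * exp (k * H m)).
  { rewrite <- psum_const; apply psum_le; intros l Hl; apply Hw; lia. }
  assert (Hy := Hyp i r).
  set (e := exp (k * (H i + H (i + r)%nat) / 2)) in *.
  assert (He : 0 < e) by apply exp_pos.
  assert (Hy2 : (k * INR r / 2) ^ 2 / 8 * e <= c * (INR r * exp (k * H m))).
  { apply Rle_trans with (sinh (k * INR r / 2) * e); [apply Rmult_le_compat_r; lra |].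
    apply Rle_trans with (1 := Hy), Rmult_le_compat_l; lra. }
  apply Rmult_le_reg_l with (k ^ 2 * INR r ^ 2); [apply Rmult_lt_0_compat; nra |].
  replace (k ^ 2 * INR r ^ 2 * (B * exp (k * H m) * / INR r))
    with (32 * (c * (INR r * exp (k * H m)))) by (unfold B; field; lra).
  lra. }
assert (Sum : psum (fun l => exp (k * H l)) (S n) <= (1 + 4 * A) * exp (k * H m)).
{ apply (psum_peak (fun l => exp (k * H l))); [assumption | assumption | left; apply exp_pos |].
  intros l r Hr Hl Hlr.
  assert (HrR : 1 <= INR r) by (apply (le_INR 1), Hr).
  assert (De : exp (k * (H l + H m) / 2) <= B * exp (k * H m) * / INR r).
  { destruct Hlr as [Hlr | Hlr].
    - rewrite <- Hlr at 1; apply Decay; lia.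
    - rewrite (Rplus_comm (H l)), Hlr; apply Decay; lia. }
  pose proof (exp_pos (k * (H l + H m) / 2)) as H0; pose proof (exp_pos (k * H m)).
  (* Squaring isolates [exp (k * H l)] and turns the decay [1 / r] into the summable [1 / r ^ 2]. *)
  apply (fun Hle => pow_incr _ _ 2 (conj (Rlt_le _ _ H0) Hle)) in De.
  replace (exp (k * (H l + H m) / 2) ^ 2) with (exp (k * H l) * exp (k * H m)) in De
    by (simpl; rewrite Rmult_1_r, <- !exp_plus; f_equal; field).
  apply Rmult_le_reg_r with (exp (k * H m)); [assumption |].
  replace (A * exp (k * H m) * / INR r ^ 2 * exp (k * H m))
    with ((B * exp (k * H m) * / INR r) ^ 2) by (unfold A; field; lra).
  exact De. }
(* The hypothesis is used again, from 0 to [n]: the sum is now bounded by a multiple of its peak,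
   and the full exponential growth of [sinh] is exploited. *)
assert (Hy := Hyp 0%nat n); simpl in Hy.
change (psum (fun l => exp (k * H l)) n + exp (k * H n) <= (1 + 4 * A) * exp (k * H m))
  in Sum.
set (e := exp (k * (H 0%nat + H n) / 2)) in *.
assert (He : e <= exp (k * H m)).
{ apply exp_le; pose proof (Hmax 0%nat ltac:(lia)); pose proof (Hmax n ltac:(lia)); nra. }
assert (He0 : 0 < e) by apply exp_pos.
pose proof (exp_pos (k * H n)).
assert (Hfin : exp (k * INR n / 2) * e <= D * exp (k * H m)).
{ replace (exp (k * INR n / 2)) with (2 * sinh (k * INR n / 2) + exp (- (k * INR n / 2)))
    by (unfold sinh; field).
  assert (exp (- (k * INR n / 2)) <= 1).
  { rewrite <- exp_0; apply exp_le; pose proof (pos_INR n); nra. }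
  unfold D.
  assert (sinh (k * INR n / 2) * e <= c * ((1 + 4 * A) * exp (k * H m))).
  { apply Rle_trans with (1 := Hy), Rmult_le_compat_l; lra. }
  nra. }
unfold e in Hfin; rewrite <- (exp_ln D HD), <- !exp_plus in Hfin.
apply ln_le in Hfin; [rewrite !ln_exp in Hfin | apply exp_pos].
apply Rmult_le_reg_l with (k / 2); [lra |].
field_simplify; [| lra]; lra.
Qed.

(** If [INR n + H n] is large, the maximum up to [n] is high, so it is reached at some [m >= n0].
    This [m] is also a maximum over the indices up to [m], and the first hypothesis at [m] itself
    gives the bound. *)
Lemma path_defect_bounded (C : R) (H : nat -> R) :
  (forall n, exists m, (m <= n)%nat /\
    (forall l, (l <= n)%nat -> H l <= H m) /\ INR n + H n <= 2 * H m + C) ->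
  (forall n, H n <= H 0%nat + INR n) ->
  (forall M, exists n, M <= INR n + H n) ->
  forall n0, exists m, (n0 <= m)%nat /\ INR m - H m <= C.
Proof.
intros Hmax Hlip Hinf n0.
destruct (Hinf (2 * (H 0%nat + INR n0) + C)) as [n Hn].
destruct (Hmax n) as (m & Hmn & Hm & Hm').
exists m; split; [apply INR_le; pose proof (Hlip m); lra |].
destruct (Hmax m) as (m' & Hm'm & _ & H').
pose proof (Hm m' ltac:(lia)); lra.
Qed.


(** * Chains and rays under the triangle inequality for [theta] *)

Lemma two_theta_exp {X : Type} (k : R) (d : X -> X -> R) (h : X -> R) (p q : X) :
  2 * theta k d h p q =
  exp (k * (d p q + h p + h q) / 2) - exp (k * (- d p q + h p + h q) / 2).
Proof.
unfold theta, sinh.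
replace (exp (k * (d p q + h p + h q) / 2))
  with (exp (k * d p q / 2) * exp (k * (h p + h q) / 2))
  by (rewrite <- exp_plus; f_equal; field).
replace (exp (k * (- d p q + h p + h q) / 2))
  with (exp (- (k * d p q / 2)) * exp (k * (h p + h q) / 2))
  by (rewrite <- exp_plus; f_equal; field).
field.
Qed.

Lemma theta_chain {X : Type} (k : R) (d : X -> X -> R) (h : X -> R) (p : nat -> X) :
  is_metric d ->
  (forall x y z, theta k d h x y <= theta k d h x z + theta k d h z y) ->
  forall i r, theta k d h (p i) (p (i + r)%nat)
    <= psum (fun l => theta k d h (p (i + l)%nat) (p (S (i + l)))) r.
Proof.
intros (_ & Hzero & _) Htri i; induction r as [| r IH]; simpl.
- rewrite Nat.add_0_r; unfold theta; replace (d (p i) (p i)) with 0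
    by (symmetry; now apply Hzero).
  rewrite Rmult_0_r, Rdiv_0_l, sinh_0; lra.
- rewrite Nat.add_succ_r.
  pose proof (Htri (p i) (p (S (i + r))) (p (i + r)%nat)); lra.
Qed.

(** The larger exponential in [2 * theta k d h (sg t) y] is [exp (k * h (sg t))] times the
    exponential of [k / 2] times the excess [d (sg t) y - (h (sg t) - h y)]. The detour through
    [sg s] adds only a constant, negligible as [h (sg t)] grows. *)
Lemma excess_vanishes {X : Type} (k : R) (d : X -> X -> R) (h : X -> R) (sg : R -> X) :
  0 < k -> (forall u v, Rabs (h u - h v) <= d u v) ->
  (forall x y z, theta k d h x y <= theta k d h x z + theta k d h z y) ->
  (forall M, exists T, forall t, T <= t -> M <= h (sg t)) ->
  (forall eps, 0 < eps -> exists s, forall t, s <= t ->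
     d (sg t) (sg s) <= h (sg t) - h (sg s) + eps) ->
  forall y eps, 0 < eps -> exists T, forall t, T <= t ->
    d (sg t) y <= h (sg t) - h y + eps.
Proof.
intros Hk Hh Htri Hinf Hrough y eps Heps.
destruct (Hrough (eps / 2) ltac:(lra)) as [s Hs].
set (Q := 2 * theta k d h (sg s) y + exp (k * h y)).
(* [G] is the factor due to the error [eps / 2], and [G ^ 2] the one allowed by [eps]; the constant
   [Q] fits in between because [2 * G - 1 <= G ^ 2]. *)
set (G := exp (k * (eps / 2) / 2)).
assert (HG : 1 < G) by (unfold G; rewrite <- exp_0; apply exp_increasing; nra).
set (R0 := Q / (G - 1)).
destruct (Hinf (R0 / k)) as [T HT].
exists (Rmax s T); intros t Ht.
pose proof (Hs t (Rle_trans _ _ _ (Rmax_l _ _) Ht)) as Hst.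
pose proof (HT t (Rle_trans _ _ _ (Rmax_r _ _) Ht)) as HRt.
pose proof (Htri (sg t) y (sg s)) as Hth.
assert (Ey := two_theta_exp k d h (sg t) y).
assert (Es := two_theta_exp k d h (sg t) (sg s)).
pose proof (exp_pos (k * (- d (sg t) (sg s) + h (sg t) + h (sg s)) / 2)).
assert (B1 : exp (k * (- d (sg t) y + h (sg t) + h y) / 2) <= exp (k * h y)).
{ apply exp_le; pose proof (Hh (sg t) y) as Hy; apply Rabs_le_between in Hy; nra. }
assert (B2 : exp (k * (d (sg t) (sg s) + h (sg t) + h (sg s)) / 2)
             <= exp (k * h (sg t)) * G).
{ unfold G; rewrite <- exp_plus; apply exp_le; nra. }
assert (B3 : Q <= exp (k * h (sg t)) * (G - 1)).
{ replace Q with (R0 * (G - 1)) by (unfold R0; field; lra).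
  apply Rmult_le_compat_r; [lra |].
  apply (Rmult_le_compat_l k) in HRt; [| lra].
  replace (k * (R0 / k)) with R0 in HRt by (field; lra).
  pose proof (exp_ineq1_le (k * h (sg t))); lra. }
pose proof (exp_pos (k * h (sg t))).
assert (B4 : exp (k * (d (sg t) y + h (sg t) + h y) / 2) <= exp (k * h (sg t)) * G * G).
{ assert (0 <= exp (k * h (sg t)) * (G - 1) ^ 2)
    by (apply Rmult_le_pos; [lra | apply pow2_ge_0]).
  unfold Q in B3; lra. }
unfold G in B4; rewrite <- !exp_plus in B4.
apply ln_le in B4; [rewrite !ln_exp in B4 | apply exp_pos].
apply Rmult_le_reg_l with (k / 2); lra.
Qed.

(** * The metric d' *)

(** Monotonicity raises [b] to [a], and [N a a = a] by homogeneity. *)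
Lemma admissible_le_l (N : R -> R -> R) (a b : R) :
  admissible_monotone_norm N -> 0 <= b <= a -> N a b <= a.
Proof.
intros (_ & Hhom & _ & H11 & _ & _ & Hmon) Hab.
apply Rle_trans with (N a a); [apply Hmon; lra |].
replace (N a a) with (N (a * 1) (a * 1)) by (f_equal; ring).
rewrite Hhom, H11, Rabs_pos_eq; lra.
Qed.

Lemma partition_le (n : nat) (t : nat -> R) (i j : nat) :
  partition n t -> (i <= j)%nat -> (j <= n)%nat -> t i <= t j.
Proof.
intros (_ & _ & Hmon) Hij; induction Hij as [| j Hij IH]; intros Hj; [lra |].
apply Rle_trans with (t j); [apply IH; lia | apply Hmon; lia].
Qed.

Lemma psum_telescope (u : nat -> R) (n : nat) : psum (fun i => u (S i) - u i) n = u n - u 0%nat.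
Proof. induction n as [| n IH]; simpl; [ring | rewrite IH; ring]. Qed.

Lemma Nlength_ge {X : Type} (d : X -> X -> R) (N : R -> R -> R) (h : X -> R)
  (p : R -> X) (x y : X) :
  admissible_monotone_norm N -> is_metric d -> cpath d p x y ->
  Rbar_le ((d x y + Rabs (h x - h y)) / 2) (Nlength N d h p).
Proof.
intros (_ & _ & _ & _ & Hlow & _) (Hpos & _) (P0 & P1 & _).
unfold Nlength.
match goal with |- Rbar_le _ (Lub_Rbar ?E) => destruct (Lub_Rbar_correct E) as [Hub _] end.
apply Rbar_le_trans with (N (d x y) (Rabs (h x - h y))).
- simpl; eapply Rle_trans; [| apply Hlow].
  rewrite Rabs_Rabsolu, (Rabs_pos_eq (d x y)) by apply Hpos; lra.
(* [INR] serves as the partition with the two nodes 0 and 1. *)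
- apply Hub; exists 1%nat, INR; split.
  + split; [reflexivity | split; [reflexivity |]]; intros i _; rewrite S_INR; lra.
  + simpl; rewrite P0, P1; ring.
Qed.

(** Each term is at most the distance it involves, because [h] is 1-Lipschitz, and distances along a
    geodesic telescope. *)
Lemma Nlength_geodesic {X : Type} (d : X -> X -> R) (N : R -> R -> R) (h : X -> R)
  (c : R -> X) (x y : X) :
  admissible_monotone_norm N -> is_metric d ->
  (forall u v, Rabs (h u - h v) <= d u v) -> geod_seg d c x y ->
  Rbar_le (Nlength N d h (fun t => c (t * d x y))) (d x y).
Proof.
intros HN (Hpos & _) Hh (C0 & C1 & Hc).
set (L := d x y) in *; assert (HL : 0 <= L) by apply Hpos.
unfold Nlength.
match goal with |- Rbar_le (Lub_Rbar ?E) _ => destruct (Lub_Rbar_correct E) as [_ Hlub] end.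
apply Hlub; intros l (n & t & Hp & ->).
pose proof Hp as (T0 & T1 & _).
simpl; apply Rle_trans with (psum (fun i => L * (t (S i) - t i)) n).
- apply psum_le; intros i Hi.
  eapply Rle_trans; [apply admissible_le_l; [assumption | split; [apply Rabs_pos | apply Hh]] |].
  pose proof (partition_le n t i (S i) Hp ltac:(lia) ltac:(lia)).
  pose proof (partition_le n t 0 i Hp ltac:(lia) ltac:(lia)).
  pose proof (partition_le n t (S i) n Hp ltac:(lia) ltac:(lia)).
  rewrite T0, T1 in *.
  rewrite Hc by (split; nra); rewrite Rabs_left1 by nra; lra.
- rewrite psum_scal, psum_telescope, T0, T1; lra.
Qed.

Lemma cpath_geodesic {X : Type} (d : X -> X -> R) (c : R -> X) (x y : X) :
  is_metric d -> geod_seg d c x y -> cpath d (fun t => c (t * d x y)) x y.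
Proof.
intros (Hpos & _) (C0 & C1 & Hc).
set (L := d x y) in *; assert (HL : 0 <= L) by apply Hpos.
split; [now rewrite Rmult_0_l | split; [now rewrite Rmult_1_l |]].
intros t Ht eps Heps; exists (eps / (L + 1)); split; [apply Rdiv_lt_0_compat; lra |].
intros s Hs Hst.
rewrite Hc by (split; nra).
rewrite <- Rmult_minus_distr_r, Rabs_mult, (Rabs_pos_eq L) by assumption.
apply (Rmult_lt_compat_r (L + 1)) in Hst; [| lra].
replace (eps / (L + 1) * (L + 1)) with eps in Hst by (field; lra).
pose proof (Rabs_pos (s - t)); lra.
Qed.

Lemma dprime_bounds {X : Type} (d : X -> X -> R) (N : R -> R -> R) (h : X -> R) (x y : X) :
  admissible_monotone_norm N -> is_metric d -> geodesic_space d ->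
  (forall u v, Rabs (h u - h v) <= d u v) ->
  (d x y + Rabs (h x - h y)) / 2 <= dprime N d h x y <= d x y.
Proof.
intros HN Hd Hgeo Hh.
destruct (Hgeo x y) as [c Hc].
pose proof (cpath_geodesic d c x y Hd Hc) as Hp.
pose proof (Nlength_geodesic d N h c x y HN Hd Hh Hc) as Hup.
pose proof (Nlength_ge d N h _ x y HN Hd Hp) as Hlo.
unfold dprime.
match goal with |- context [Glb_Rbar ?E] => destruct (Glb_Rbar_correct E) as [Hlb Hglb] end.
set (G := Glb_Rbar _) in *.
assert (G1 : Rbar_le ((d x y + Rabs (h x - h y)) / 2) G).
{ apply Hglb; intros l (p & Hp' & El); rewrite <- El; now apply Nlength_ge. }
assert (G2 : Rbar_le G (d x y)).
(* Only finite lengths enter the infimum. The two bounds show that the geodesic has one, and then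
   that the infimum is finite, so [real] returns its true value. *)
{ destruct (Nlength N d h (fun t => c (t * d x y))) as [l | |] eqn:El; try contradiction.
  apply Rbar_le_trans with l; [| exact Hup].
  apply Hlb; eexists; split; [exact Hp | exact El]. }
destruct G as [r | |]; try contradiction; now split.
Qed.

(** * The defect of d'-geodesic rays *)

Lemma defect_converges (E : R -> R) (C : R) :
  (forall s t, 0 <= s <= t -> E s <= E t) ->
  (forall n0, exists m, (n0 <= m)%nat /\ E (INR m) <= C) ->
  exists l, (forall t, 0 <= t -> E t <= l) /\
    forall eps, 0 < eps -> exists s, 0 <= s /\ l - eps < E s.
Proof.
intros Hmon Hbd.
destruct (completeness (fun r => exists t, 0 <= t /\ r = E t)) as [l [Hub Hlub]].
- exists C; intros r (t & Ht & ->).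
  destruct (Hbd (Z.to_nat (up t))) as (m & Hm & HC).
  apply Rle_trans with (2 := HC), Hmon; split; [assumption |].
  destruct (archimed t) as [Hup _].
  assert (0 <= up t)%Z by (apply le_IZR; lra).
  apply le_INR in Hm; rewrite INR_IZR_INZ, Z2Nat.id in Hm by assumption; lra.
- exists (E 0), 0; split; [lra | reflexivity].
- exists l; split; [intros t Ht; apply Hub; now exists t |].
  intros eps Heps; apply Classical_Prop.NNPP; intros Hno.
  enough (l <= l - eps) by lra.
  apply Hlub; intros r (t & Ht & ->).
  apply Rnot_lt_le; intros Hlt; apply Hno; now exists t.
Qed.

(* [sg] is a d'-geodesic ray, seen through the bounds (d + |dh|)/2 <= d' <= d; the last
   hypothesis excludes rays descending to a boundary point other than infinity. *)
Lemma dprime_ray_vertical {X : Type} (k : R) (d : X -> X -> R) (h : X -> R) (sg : R -> X) :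
  0 < k -> is_metric d ->
  (forall x y z, theta k d h x y <= theta k d h x z + theta k d h z y) ->
  (forall s t, 0 <= s <= t ->
     t - s <= d (sg s) (sg t) /\
     d (sg s) (sg t) + Rabs (h (sg s) - h (sg t)) <= 2 * (t - s)) ->
  (forall M, exists K, forall s, K <= s -> M <= s + h (sg s)) ->
  exists l, (forall t, 0 <= t -> t - h (sg t) <= l) /\
    forall eps, 0 < eps -> exists s, 0 <= s /\ l - eps < s - h (sg s).
Proof.
intros Hk Hd Htri Hray Hinf.
assert (Hlip : forall s t, 0 <= s <= t -> Rabs (h (sg s) - h (sg t)) <= t - s).
{ intros s t Hst; destruct (Hray s t Hst); lra. }
set (p := fun n => sg (INR n)).
(* In unit time [d] is at most 2 and the height gains at most 1, whence the factors [sinh k] and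
   [exp (k / 2)]. *)
assert (Hstep : forall i, theta k d h (p i) (p (S i))
  <= sinh k * exp (k / 2) * exp (k * h (p i))).
{ intros i; unfold theta, p; rewrite S_INR; pose proof (pos_INR i).
  destruct (Hray (INR i) (INR i + 1) ltac:(lra)) as [H1 H2].
  pose proof (Hlip (INR i) (INR i + 1) ltac:(lra)) as H3.
  pose proof (Rabs_pos (h (sg (INR i)) - h (sg (INR i + 1)))).
  apply Rabs_le_between in H3.
  rewrite Rmult_assoc, <- exp_plus.
  apply Rmult_le_compat; [apply sinh_ge_0; nra | left; apply exp_pos | |].
  - apply sinh_le; nra.
  - apply exp_le; nra. }
set (c := sinh k * exp (k / 2)) in *.
assert (Hc : 0 < c) by (apply Rmult_lt_0_compat; [now apply sinh_gt_0 | apply exp_pos]).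
destruct (path_rises_then_falls k c (fun n => h (p n)) Hk Hc) as [C HC].
{ intros i r.
  apply Rle_trans with (theta k d h (p i) (p (i + r)%nat)).
  - apply Rmult_le_compat_r; [left; apply exp_pos |].
    apply sinh_le; unfold p; rewrite plus_INR.
    pose proof (pos_INR i); pose proof (pos_INR r).
    destruct (Hray (INR i) (INR i + INR r) ltac:(lra)) as [H1 _]; nra.
  - rewrite <- psum_scal.
    eapply Rle_trans; [now apply theta_chain | apply psum_le; intros; apply Hstep]. }
apply (defect_converges (fun t => t - h (sg t)) C).
- intros s t Hst; pose proof (Hlip s t Hst) as H; apply Rabs_le_between in H; lra.
- apply (path_defect_bounded C (fun n => h (p n)) HC).
  + intros n; unfold p; simpl; pose proof (pos_INR n).
    pose proof (Hlip 0 (INR n) ltac:(lra)) as H'; apply Rabs_le_between in H'; lra.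
  + intros M; destruct (Hinf M) as [K HK].
    (* If [up K] is negative the index is 0, which still exceeds [K]. *)
    exists (Z.to_nat (up K)); apply HK.
    destruct (archimed K) as [Hup _].
    rewrite INR_IZR_INZ.
    pose proof (IZR_le _ _ (Z.le_max_l (up K) 0)) as Hmax.
    destruct (Z.le_ge_cases 0 (up K)) as [Hz | Hz].
    * rewrite Z2Nat.id by assumption; lra.
    * apply IZR_le in Hz; apply Rle_trans with 0; [lra | apply (IZR_le 0); lia].
Qed.

Theorem mainTheorem12 (X : Type) (d : X -> X -> R) (kappa : R)
  (g : R -> X) (x0 : X) (N : R -> R -> R) (f : X -> X) :
  0 < kappa ->
  is_metric d -> proper_space d -> geodesically_complete d -> CAT_neg kappa d ->
  geod_ray d g ->
  admissible_monotone_norm N ->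
  isometry (dprime N d (height d g x0)) f ->
  fixes_boundary_point (dprime N d (height d g x0)) x0 f g ->
  forall x y : X,
    height d g x0 (f x) - height d g x0 x = height d g x0 (f y) - height d g x0 y.
Proof.
intros Hkappa Hd _ _ Hcat Hg HN [Hsurj Hiso] Hfix.
set (h := height d g x0) in *; set (d' := dprime N d h) in *.
set (k := sqrt kappa); assert (Hk : 0 < k) by now apply sqrt_lt_R0.
pose proof Hd as (Hpos & _ & Hsym & Htr).
pose proof (proj1 Hcat) as Hgeo.
assert (Hh : forall u v, Rabs (h u - h v) <= d u v)
  by (intros; now apply height_Lipschitz).
pose proof (CAT_neg_stewart kappa d Hkappa Hd Hcat) as HS.
pose proof (stewart_horo k d g x0 Hk Hd Hg HS) as HH.
assert (Htri : forall x y z, theta k d h x y <= theta k d h x z + theta k d h z y)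
  by (intros; now apply theta_triangle).
assert (Hd' : forall u v, (d u v + Rabs (h u - h v)) / 2 <= d' u v <= d u v)
  by (intros; now apply dprime_bounds).
destruct (ex_busemann d g x0 Hd Hg) as [b0 Hb0].
assert (Hhg : forall t, 0 <= t -> h (g t) = b0 + t) by (intros; now apply height_ray).
(* Along [g] the height grows at unit speed, so the lower and upper bounds for [d'] coincide. *)
assert (Hd'g : forall s t, 0 <= s <= t -> d' (g s) (g t) = t - s).
{ intros s t Hst; destruct (Hd' (g s) (g t)) as [H1 H2].
  rewrite !Hhg in H1 by lra; rewrite (Hg s t) in H1, H2 by lra.
  replace (b0 + s - (b0 + t)) with (s - t) in H1 by ring.
  rewrite Rabs_left1 in H1, H2 by lra; lra. }
set (sg := fun t => f (g t)).
assert (Hray : forall s t, 0 <= s <= t ->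
     t - s <= d (sg s) (sg t) /\
     d (sg s) (sg t) + Rabs (h (sg s) - h (sg t)) <= 2 * (t - s)).
{ intros s t Hst; destruct (Hd' (sg s) (sg t)) as [H1 H2].
  assert (E : d' (sg s) (sg t) = t - s) by (unfold sg, d'; rewrite Hiso; now apply Hd'g).
  lra. }
destruct (dprime_ray_vertical k d h sg Hk Hd Htri Hray) as (l & Hl & Hl').
(* At equal times the Gromov product of [f (g s)] and [g s] is at most half of [s + h (sg s)] plus a
   constant: both points are within [s] plus a constant of [x0], and the difference of their heights
   keeps them apart. *)
{ intros M; destruct (Hsurj x0) as [w Hw].
  destruct (Hfix ((M + d (g 0) w + d (g 0) x0 - b0) / 2)) as [K HK].
  exists (Rmax K 0); intros s Hs.
  pose proof (Rle_trans _ _ _ (Rmax_l K 0) Hs); pose proof (Rle_trans _ _ _ (Rmax_r K 0) Hs).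
  pose proof (HK s s ltac:(lra) ltac:(lra)) as HM; unfold gromov in HM.
  fold (sg s) in HM.
  assert (A1 : d' (sg s) x0 <= s + d (g 0) w).
  { rewrite <- Hw; unfold sg, d'; rewrite Hiso; fold d'.
    apply Rle_trans with (1 := proj2 (Hd' _ _)).
    pose proof (Htr (g s) (g 0) w) as T; rewrite (Hg s 0), Rabs_pos_eq in T; lra. }
  assert (A2 : d' (g s) x0 <= s + d (g 0) x0).
  { apply Rle_trans with (1 := proj2 (Hd' _ _)).
    pose proof (Htr (g s) (g 0) x0) as T; rewrite (Hg s 0), Rabs_pos_eq in T; lra. }
  assert (A3 : b0 + s - h (sg s) <= d' (sg s) (g s)).
  { rewrite <- Hhg by assumption; destruct (Hd' (sg s) (g s)) as [H1 _].
    pose proof (Hh (sg s) (g s)) as H2; pose proof (Rle_abs (h (g s) - h (sg s))) as H3.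
    rewrite Rabs_minus_sym in H3; lra. }
  lra. }
assert (Hexc : forall y eps, 0 < eps -> exists T, forall t, T <= t ->
    d (sg t) y <= h (sg t) - h y + eps).
{ apply (excess_vanishes k d h sg Hk Hh Htri).
  - intros M; exists (Rmax 0 (M + l)); intros t Ht.
    pose proof (Rle_trans _ _ _ (Rmax_l _ _) Ht) as T1.
    pose proof (Rle_trans _ _ _ (Rmax_r _ _) Ht); pose proof (Hl t T1); lra.
  (* The defects at [s] and [t] differ by less than [eps / 2], so [2 * (t - s)] exceeds twice the
     gain in height by less than [eps]. *)
  - intros eps Heps; destruct (Hl' (eps / 2) ltac:(lra)) as (s & Hs & Hls).
    exists s; intros t Ht; rewrite Hsym.
    destruct (Hray s t ltac:(lra)) as [_ H1]; pose proof (Hl t ltac:(lra)).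
    pose proof (Rle_abs (h (sg t) - h (sg s))) as H3; rewrite Rabs_minus_sym in H3.
    lra. }
(* [b0] normalises the Busemann function of [g], and [l] is the limit of the defect of [sg]. *)
enough (Hmain : forall x, h (f x) - h x = - b0 - l)
  by (intros x y; now rewrite !Hmain).
intros x.
assert (Hlim : is_lim (fun t => d (g t) x - t) p_infty (b0 - h x)) by now apply is_lim_height.
assert (Hlow : forall t, 0 <= t -> h (sg t) - h (f x) <= d (g t) x).
{ intros t Ht; apply Rle_trans with (2 := proj2 (Hd' (g t) x)).
  unfold d'; rewrite <- Hiso; fold d'; fold (sg t).
  destruct (Hd' (sg t) (f x)) as [H1 _]; pose proof (Hh (sg t) (f x)).
  pose proof (Rle_abs (h (sg t) - h (f x))); lra. }
assert (G1 : - l - h (f x) <= b0 - h x).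
{ apply (is_lim_le_loc (fun _ => - l - h (f x)) (fun t => d (g t) x - t) p_infty
    (- l - h (f x)) (b0 - h x)); [| apply is_lim_const | exact Hlim].
  exists 0; intros t Ht; pose proof (Hlow t ltac:(lra)); pose proof (Hl t ltac:(lra)); lra. }
assert (G2 : forall eps, 0 < eps -> b0 - h x <= - l - h (f x) + eps).
{ intros eps Heps.
  destruct (Hexc (f x) (eps / 2) ltac:(lra)) as [T HT].
  destruct (Hl' (eps / 4) ltac:(lra)) as (s & Hs & Hls).
  (* The lower bound for [d'] is solved for [d (g t) x], which brings in a factor 2 and a second
     copy of [b0 - h x]. *)
  enough (b0 - h x <= 2 * (- l - h (f x) + eps) - (b0 - h x)) by lra.
  apply (is_lim_le_loc (fun t => d (g t) x - t)
    (fun _ => 2 * (- l - h (f x) + eps) - (b0 - h x)) p_infty (b0 - h x)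
    (2 * (- l - h (f x) + eps) - (b0 - h x))); [| exact Hlim | apply is_lim_const].
  exists (Rmax s T); intros t Ht.
  assert (Hst : s < t) by (apply Rle_lt_trans with (2 := Ht), Rmax_l).
  assert (HTt : T < t) by (apply Rle_lt_trans with (2 := Ht), Rmax_r).
  assert (Hup : d' (g t) x <= d (sg t) (f x)).
  { unfold d'; rewrite <- Hiso; apply (Hd' (sg t) (f x)). }
  pose proof (HT t ltac:(lra)); destruct (Hray s t ltac:(lra)) as [H1 H2].
  pose proof (Rle_abs (h (sg t) - h (sg s))) as H3; rewrite Rabs_minus_sym in H3.
  destruct (Hd' (g t) x) as [H4 _]; pose proof (Rle_abs (h (g t) - h x)) as H5.
  rewrite Hhg in H4, H5 by lra; lra. }
apply Rle_antisym.
- apply le_epsilon; intros eps Heps; pose proof (G2 eps Heps); lra.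
- lra.
Qed.
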